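(* Let $\mathcal{M},s$ and $\mathcal{M}',s'$ be pointed dependence epistemic models (over the same $\mathbb{P},\mathbb{V}$). Let $\mathcal{D}$ be either $\mathcal{D}_g$ (with $\mathcal{P}=\mathcal{P}_g$) or $\mathcal{D}_l$ (with $\mathcal{P}=\mathcal{P}_l$). Then for all finite $X,Y\subseteq\mathbb{V}$ ($\mathcal{M},s\vDash\mathcal{D}(X,Y)$ iff $\mathcal{M}',s'\vDash\mathcal{D}(X,Y)$) holds if and only if both: (Zig) every $W\in\mathcal{P}(s)$ is generative from $\mathcal{P}(s')$; and (Zag) every $W\in\mathcal{P}(s')$ is generative from $\mathcal{P}(s)$.
   Context: Fix a countable set $\mathbb{P}$ of propositions and a countable set $\mathbb{V}$ of variables. A dependence epistemic model is $\mathcal{M}=\langle S,T,V,U,\sim_i,\approx\rangle$ where $S$ is a set of worlds, $T:S\times\mathbb{P}\to\{0,1\}$, $V\supseteq\mathbb{V}$ is a countable set of variables, $U:S\times V\to\mathbb{N}$, and $\sim_i,\approx$ are equivalence relations on $S$. For $s,t\in S$ and $X\subseteq V$, write $X_s=X_t$ iff $U(s,x)=U(t,x)$ for all $x\in X$, and $X_s\neq X_t$ otherwise. Semantics (for finite $X,Y\subseteq\mathbb{V}$): $\mathcal{M},s\vDash\mathcal{D}_g(X,Y)$ iff there exist $u,v\in S$ with $u\approx v\approx s$, $(V\setminus(X\cup Y))_u=(V\setminus(X\cup Y))_v$, $X_u\neq X_v$ and $Y_u\neq Y_v$; $\mathcal{M},s\vDash\mathcal{D}_l(X,Y)$ iff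 there exists $t\in S$ with $t\approx s$, $(V\setminus(X\cup Y))_t=(V\setminus(X\cup Y))_s$, $X_t\neq X_s$ and $Y_t\neq Y_s$. For $u,v\in S$, $\Delta(u,v)=\{x\in\mathbb{V}\mid U(u,x)\neq U(v,x)\}$ if $(V\setminus\mathbb{V})_u=(V\setminus\mathbb{V})_v$, and $\Delta(u,v)=\emptyset$ otherwise. $W$ is an evidence of $\langle X,Y\rangle$ iff $W\cap X\neq\emptyset$, $W\cap Y\neq\emptyset$, $W\subseteq X\cup Y$. $\mathcal{P}_g(s)=\{\Delta(u,v)\mid u,v\in S,\ u\approx v\approx s,\ \Delta(u,v)\text{ nonempty finite}\}$ and $\mathcal{P}_l(s)=\{\Delta(t,s)\mid t\in S,\ t\approx s,\ \Delta(t,s)\text{ nonempty finite}\}$. A nonempty finite $W\subseteq\mathbb{V}$ is generative from $\mathcal{P}(s)$ iff for all finite $X,Y\subseteq\mathbb{V}$ such that $W$ is an evidence of $\langle X,Y\rangle$, there is $W'\in\mathcal{P}(s)$ that is also an evidence of $\langle X,Y\rangle$. *)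

(* Defs.v *)
From mathcomp Require Import all_boot all_classical.
From Stdlib Require Import RelationClasses.

Set Implicit Arguments.
Unset Strict Implicit.
Unset Printing Implicit Defensive.

Local Open Scope classical_set_scope.

(* [I] is the set of agents, [PP] the countable set of propositions and [VV]
   the countable set of variables that occur in formulas.  The inclusion of
   [VV] in the variable set [var] of a model is the injection [emb]. *)
Record dep_model (I : Type) (PP VV : countType) := DepModel {
  world : Type;
  truth : world -> PP -> bool;
  var : countType;
  emb : VV -> var;
  emb_inj : injective emb;
  value : world -> var -> nat;
  indist : I -> world -> world -> Prop;
  indist_equiv : forall i, Equivalence (indist i);
  approx : world -> world -> Prop;
  approx_equiv : Equivalence approx
}.

Section Semantics.
Context {I : Type} {PP VV : countType} (M : dep_model I PP VV).
Implicit Types (s t u v : world M) (X Y W : set VV).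

(* [agree A s t] is the relation A_s = A_t. *)
Definition agree (A : set (var M)) s t : Prop :=
  forall x, A x -> value s x = value t x.

Definition sat_Dg s X Y : Prop :=
  exists u v : world M,
    (approx u v /\ approx v s) /\
    [/\ agree (~` (emb M @` (X `|` Y))) u v,
        ~ agree (emb M @` X) u v &
        ~ agree (emb M @` Y) u v].

Definition sat_Dl s X Y : Prop :=
  exists t : world M,
    approx t s /\
    [/\ agree (~` (emb M @` (X `|` Y))) t s,
        ~ agree (emb M @` X) t s &
        ~ agree (emb M @` Y) t s].

Definition Delta u v : set VV :=
  if `[< agree (~` range (emb M)) u v >]
  then [set x | value u (emb M x) <> value v (emb M x)]
  else set0.

Definition Pg s : set (set VV) :=
  [set W | exists u v : world M,
     [/\ approx u v /\ approx v s, W = Delta u v, W !=set0 & finite_set W]].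

Definition Pl s : set (set VV) :=
  [set W | exists t : world M,
     [/\ approx t s, W = Delta t s, W !=set0 & finite_set W]].

End Semantics.

Definition evidence {VV : countType} (W X Y : set VV) : Prop :=
  [/\ W `&` X !=set0, W `&` Y !=set0 & W `<=` X `|` Y].

Definition generative {VV : countType} (W : set VV) (P : set (set VV)) : Prop :=
  [/\ W !=set0, finite_set W &
      forall X Y : set VV, finite_set X -> finite_set Y ->
        evidence W X Y -> exists2 W', P W' & evidence W' X Y].

Inductive dep_kind := Global | Local.

Definition sat_D (k : dep_kind) {I : Type} {PP VV : countType}
    (M : dep_model I PP VV) (s : world M) : set VV -> set VV -> Prop :=
  match k with Global => sat_Dg s | Local => sat_Dl s end.

Definition PD (k : dep_kind) {I : Type} {PP VV : countType}
    (M : dep_model I PP VV) (s : world M) : set (set VV) :=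
  match k with Global => Pg s | Local => Pl s end.

(* Main.v *)
Require Import Defs.
From mathcomp Require Import all_boot all_classical.

Local Open Scope classical_set_scope.

(** [Delta u v] is exactly the set on which a pair witnessing [D(X, Y)] differs,
    so for finite [X] and [Y] the formula [D(X, Y)] holds at [s] iff some member
    of [PD k s] is an evidence of [<X, Y>].  Under this translation, agreement on
    all formulas [D(X, Y)] is Zig and Zag. *)

Lemma nagreeP {I : Type} {PP VV : countType} (M : dep_model I PP VV)
    (u v : world M) (X : set VV) :
  ~ agree (emb M @` X) u v <->
  [set x | value u (emb M x) <> value v (emb M x)] `&` X !=set0.
Proof.
split=> [nag|[x [neq Xx]] ag]; last by apply: neq; apply: ag; exists x.
apply: contrapT => none; apply: nag => _ [x Xx <-].
by apply: contrapT => neq; apply: none; exists x.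
Qed.

(** The variables outside the image of [Z] are those outside the range of [emb] together with the
    images of those outside [Z]; injectivity of [emb] keeps the latter out of the image of [Z]. *)
Lemma agreeC_emb_imageP {I : Type} {PP VV : countType} (M : dep_model I PP VV)
    (u v : world M) (Z : set VV) :
  agree (~` (emb M @` Z)) u v <->
  agree (~` range (emb M)) u v /\
  [set x | value u (emb M x) <> value v (emb M x)] `<=` Z.
Proof.
split=> [ag|[ag sub] y nZy].
  split=> [y ny|x neq]; first by apply: ag => -[x _ xy]; apply: ny; exists x.
  apply: contrapT => nZx; apply: neq; apply: ag => -[z Zz /emb_inj zx].
  by apply: nZx; rewrite -zx.
have [[x _ xy]|] := pselect (range (emb M) y); last exact: ag.
by apply: contrapT => neq; apply: nZy; exists x => //; apply: sub => /=; rewrite xy.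
Qed.

Lemma evidence_DeltaP {I : Type} {PP VV : countType} (M : dep_model I PP VV)
    (u v : world M) (X Y : set VV) :
  [/\ agree (~` (emb M @` (X `|` Y))) u v,
      ~ agree (emb M @` X) u v & ~ agree (emb M @` Y) u v] <->
  evidence (Delta u v) X Y.
Proof.
rewrite /Delta; case: asboolP => ag.
  split=> [[/agreeC_emb_imageP[_ sub] /nagreeP dX /nagreeP dY]|[dX dY sub]] //.
  by split; [apply/agreeC_emb_imageP|apply/nagreeP|apply/nagreeP].
(* Disagreement outside the range of [emb] refutes the left side; [Delta u v] is then [set0], which
   does not meet [X]. *)
by split=> [[/agreeC_emb_imageP[]] //|[[x []]]].
Qed.

Lemma evidence_nonempty {VV : countType} (W X Y : set VV) :
  evidence W X Y -> W !=set0.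
Proof. by case=> -[x [Wx _]] _ _; exists x. Qed.

Lemma evidence_finite {VV : countType} (W X Y : set VV) :
  finite_set X -> finite_set Y -> evidence W X Y -> finite_set W.
Proof.
by move=> fX fY [_ _ sub]; apply: sub_finite_set sub _; rewrite finite_setU.
Qed.

(** [PD k s] keeps only nonempty finite difference sets, but no witness is lost: an evidence of
    [<X, Y>] meets [X] and lies in the union of the finite sets [X] and [Y]. *)
Lemma sat_D_evidenceP (k : dep_kind) {I : Type} {PP VV : countType}
    (M : dep_model I PP VV) (s : world M) (X Y : set VV) :
  finite_set X -> finite_set Y ->
  sat_D k s X Y <-> exists2 W, PD k s W & evidence W X Y.
Proof.
move=> fX fY; case: k => /=; split.
- move=> [u [v [uvs /evidence_DeltaP ev]]]; exists (Delta u v) => //.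
  exists u, v; split=> //; first exact: evidence_nonempty ev.
  exact: evidence_finite ev.
- move=> [_ [u [v [uvs -> _ _]]] /evidence_DeltaP ev].
  by exists u, v.
- move=> [t [ts /evidence_DeltaP ev]]; exists (Delta t s) => //.
  exists t; split=> //; first exact: evidence_nonempty ev.
  exact: evidence_finite ev.
- by move=> [_ [t [ts -> _ _]] /evidence_DeltaP ev]; exists t.
Qed.

Lemma PD_nonempty_finite (k : dep_kind) {I : Type} {PP VV : countType}
    (M : dep_model I PP VV) (s : world M) (W : set VV) :
  PD k s W -> W !=set0 /\ finite_set W.
Proof. by case: k => [[u [v []]]|[t []]]. Qed.

(** An implication whose premise asserts that some [W] exists is the same as one for every [W]. Zig
    is thus preservation from [s] to [s'], and Zag is the same with the roles exchanged. *)
Lemma generative_PDP (k : dep_kind) {I : Type} {PP VV : countType}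
    (M M' : dep_model I PP VV) (s : world M) (s' : world M') :
  (forall X Y : set VV, finite_set X -> finite_set Y ->
     sat_D k s X Y -> sat_D k s' X Y) <->
  (forall W : set VV, PD k s W -> generative W (PD k s')).
Proof.
split=> [imp W PW|gen X Y fX fY /(sat_D_evidenceP k _ s X Y fX fY)[W PW ev]].
  (* These are the two side conditions in [generative]. *)
  have [W0 fW] := PD_nonempty_finite k M s W PW.
  split=> // X Y fX fY ev; apply/sat_D_evidenceP => //.
  by apply: imp => //; apply/sat_D_evidenceP => //; exists W.
by apply/sat_D_evidenceP => //; have [_ _] := gen W PW; apply.
Qed.

Theorem mainTheorem3 (I : Type) (PP VV : countType)
    (M M' : dep_model I PP VV) (s : world M) (s' : world M') (k : dep_kind) :
  (forall X Y : set VV, finite_set X -> finite_set Y ->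
     (sat_D k s X Y <-> sat_D k s' X Y))
  <->
  ((forall W : set VV, PD k s W -> generative W (PD k s')) /\
   (forall W : set VV, PD k s' W -> generative W (PD k s))).
Proof.
split=> [eqv|[/generative_PDP zig /generative_PDP zag] X Y fX fY].
  by split; apply/generative_PDP => X Y fX fY /(eqv X Y fX fY).
by split; [apply: zig|apply: zag].
Qed.
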